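(* Let $n\ge 2$ and let $(g_{ij})_{1\le i<j\le n}$ be reals with $g_{il}+g_{jk}>g_{ik}+g_{jl}$ for all $1\le i<j<k<l\le n$ and $g_{il}>g_{ik}+g_{kl}$ for all $1\le i<k<l\le n$. Let $\bar X_g=\{v\in\mathbb{R}^n: v_1=0,\ v_j-v_i\ge g_{ij}\ \forall i<j\}$ and $X_g=\{v\in\bar X_g: v_n-v_1=g_{1n}\}$. For $v\in\bar X_g$ let $E(v)=\{ij: i<j,\ v_j-v_i=g_{ij}\}$. Then $X_g$ is a simple $(n-2)$-dimensional polytope whose face poset is that of the $(n-2)$-dimensional associahedron; $v\mapsto E(v)$ gives a bijection between the vertices of $X_g$ and the non-crossing alternating trees on $\{1,\dots,n\}$, and two vertices are adjacent if and only if the corresponding trees differ in a single edge. Moreover $\bar X_g$ is an unbounded polyhedron with the same vertex set as $X_g$, and its extreme rays correspond to the non-crossing alternating trees with the edge $1n$ removed.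
   Context: A graph on $\{1,\dots,n\}$ is alternating if it has no two edges $ij,jk$ with $i<j<k$; non-crossing if it has no two edges $ik,jl$ with $i<j<k<l$. A non-crossing alternating tree is a spanning tree on $\{1,\dots,n\}$ with both properties. *)

(* Defs.v *)
From HB Require Import structures.
From mathcomp Require Import all_boot all_order all_algebra.
From mathcomp Require Import boolp classical_sets reals.
Set Implicit Arguments. Unset Strict Implicit. Unset Printing Implicit Defensive.
Import Order.TTheory GRing.Theory Num.Theory.
Local Open Scope ring_scope.
Local Open Scope classical_set_scope.

(* Points of R^n are row vectors 'rV[R]_n; coordinate j of v is v 0 j.
   Indices 1..n of the paper are the ordinals 0..n-1 of 'I_n. *)

Section Polyhedra.
Variables (R : realType) (n : nat).
Implicit Types (S F : set 'rV[R]_n) (u v x c : 'rV[R]_n).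

Definition dotv c x : R := \sum_(j < n) c 0 j * x 0 j.

Definition affine_indep k (p : 'I_k.+1 -> 'rV[R]_n) : bool :=
  row_free (\matrix_(i < k, j < n) (p (lift ord0 i) 0 j - p ord0 0 j)).

Definition affdim S (d : nat) : Prop :=
  (exists p : 'I_d.+1 -> 'rV[R]_n, (forall i, S (p i)) /\ affine_indep p) /\
  (forall p : 'I_d.+2 -> 'rV[R]_n, (forall i, S (p i)) -> ~~ affine_indep p).

Definition bounded S := exists M : R, forall x, S x -> forall j, `|x 0 j| <= M.

(* F is a face of S: the intersection of S with a supporting hyperplane
   of a valid inequality (c = 0, d = 0 gives S itself) *)
Definition face S F := exists (c : 'rV[R]_n) (d : R),
  (forall x, S x -> dotv c x <= d) /\ F = [set x | S x /\ dotv c x = d].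

Definition nonempty_face S F := face S F /\ F !=set0.

Definition vertex S v := face S [set v].

Definition facet S F :=
  face S F /\ F !=set0 /\ exists d, affdim S d.+1 /\ affdim F d.

Definition adjacent S u v :=
  u != v /\ exists F, face S F /\ affdim F 1 /\ F u /\ F v.

Definition ext_ray S F := face S F /\ affdim F 1 /\ ~ bounded F.

Definition exactly_k (P : set (set 'rV[R]_n)) (k : nat) :=
  exists f : 'I_k -> set 'rV[R]_n,
    injective f /\ (forall i, P (f i)) /\ forall F, P F -> exists i, F = f i.

Definition simple_polytope S (d : nat) :=
  bounded S /\ S !=set0 /\ affdim S d /\
  forall v, vertex S v -> exactly_k [set F | facet S F /\ F v] d.

End Polyhedra.

Section Trees.
Variable n : nat.
Implicit Types T : {set 'I_n * 'I_n}.
(* a graph on {1..n}: edge ij (i<j) is stored as the pair (i, j) *)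

Definition adjrel T : rel 'I_n := fun x y => ((x, y) \in T) || ((y, x) \in T).

Definition spanning_tree T :=
  [&& [forall p in T, (p.1 < p.2)%N],
      [forall x, forall y, connect (adjrel T) x y] & #|T| == n.-1].

Definition alternating T :=
  [forall i, forall j, forall k,
     ~~ [&& (i, j) \in T, (j, k) \in T, (i < j)%N & (j < k)%N]].

Definition noncrossing T :=
  [forall i, forall j, forall k, forall l,
     ~~ [&& (i, k) \in T, (j, l) \in T, (i < j)%N, (j < k)%N & (k < l)%N]].

Definition nc_alt_tree T := [&& spanning_tree T, alternating T & noncrossing T].

Definition edge1n : {set 'I_n * 'I_n} :=
  [set p | (val p.1 == 0%N) && (val p.2 == n.-1)].
End Trees.

(* Combinatorial associahedron: a polygon with vertices 'I_m; a dissection is a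
   set of pairwise non-crossing diagonals.  The face poset of the
   (m-3)-dimensional associahedron is the set of dissections of the m-gon
   ordered by reverse inclusion. *)
Definition diagonal m (p : 'I_m * 'I_m) :=
  (p.1.+1 < p.2)%N && ~~ ((val p.1 == 0%N) && (val p.2 == m.-1)).

Definition dissection m (D : {set 'I_m * 'I_m}) :=
  [forall p in D, diagonal p] &&
  [forall p in D, forall q in D, ~~ [&& (p.1 < q.1)%N, (q.1 < p.2)%N & (p.2 < q.2)%N]].

Section Xg.
Variables (R : realType) (n : nat) (g : 'I_n -> 'I_n -> R).

Definition Xbar : set 'rV[R]_n :=
  [set v | (forall i : 'I_n, val i = 0%N -> v 0 i = 0) /\
           forall i j : 'I_n, (i < j)%N -> g i j <= v 0 j - v 0 i].

Definition Xg : set 'rV[R]_n :=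
  [set v | Xbar v /\
     forall i j : 'I_n, val i = 0%N -> val j = n.-1 -> v 0 j - v 0 i = g i j].

Definition Eset (v : 'rV[R]_n) : {set 'I_n * 'I_n} :=
  [set p : 'I_n * 'I_n | (p.1 < p.2)%N && (v 0 p.2 - v 0 p.1 == g p.1 p.2)].

Definition Eface (F : set 'rV[R]_n) : {set 'I_n * 'I_n} :=
  [set p : 'I_n * 'I_n | (p.1 < p.2)%N &&
     `[< forall v, F v -> v 0 p.2 - v 0 p.1 = g p.1 p.2 >]].
End Xg.

(* Main.v *)
(* Call a set of edges compatible if it is alternating and non-crossing; both
   conditions together say that no two edges [ik], [jl] satisfy
   [i < j <= k < l].  The inequalities on [g] force [E(v)] to be compatible.
   Conversely every compatible [D] is [E(v)] for some [v].  By induction on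
   intervals [[a, b]], cut between [k] and [k+1] where no edge of [D] other
   than [ab] passes over the cut, and put the two solutions at the distance
   making [ab] tight: this gives [v] with [D] contained in [E(v)] and [E(v)]
   connected.  Applied to [g] increased slightly off [D], it gives [E(v) = D].
   Hence the faces of the two polyhedra are the sets [D <= E(v)] with [D]
   compatible, and, since removing a single edge of [D] is always realizable,
   the equations of [D] are independent, which gives all dimensions.  Finally
   the edge [ij] corresponds to the diagonal [i, j+1] of the [(n+1)]-gon,
   compatibility of edges being non-crossing of diagonals. *)

Require Import Defs.
From HB Require Import structures.
From mathcomp Require Import all_boot all_order all_algebra.
From mathcomp Require Import zify lra.
From mathcomp Require Import boolp classical_sets reals.
Set Implicit Arguments. Unset Strict Implicit. Unset Printing Implicit Defensive.
Import Order.TTheory GRing.Theory Num.Theory.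
Local Open Scope ring_scope.
Local Open Scope classical_set_scope.

Lemma finite_pos_lower_bound (R : realType) (I : finType) (P : pred I)
    (f : I -> R) :
  (forall i, P i -> 0 < f i) ->
  exists2 e : R, 0 < e & forall i, P i -> e < f i.
Proof.
move=> f_gt0.
suff [e e0 He] : exists2 e : R, 0 < e & forall i, i \in enum I -> P i -> e < f i.
  by exists e => // i; apply: He; rewrite mem_enum.
elim: (enum I) => [|x s [e e0 He]]; first by exists 1.
case Px: (P x); last first.
  by exists e => // i; rewrite inE => /orP[/eqP->|/He//]; rewrite Px.
have fx := f_gt0 x Px.
exists (Num.min e (f x / 2)).
  by rewrite lt_min e0 divr_gt0.
move=> i; rewrite inE gt_min => /orP[/eqP->|/He Hi] Pi; last by rewrite Hi.
by apply/orP; right; lra.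
Qed.

(** * Compatible graphs and tight solutions on intervals of integers *)

Section Intervals.
Variables (R : realType) (N : nat).

Definition compatible (D : nat -> nat -> bool) :=
  forall i j k l, D i k -> D j l -> (i < j <= k)%N -> (k < l)%N -> False.

(** The cut goes after the largest neighbour [k < b] of [a], or after [a] itself if there is none.
    An edge over the cut starting at [a] ends at [b] by maximality; one starting later forms the
    forbidden pattern with the edge from [a] to [k]. *)
Lemma compatible_split (D : nat -> nat -> bool) (a b : nat) :
  compatible D -> (a < b)%N ->
  exists2 k, (a <= k < b)%N &
    forall i j, (a <= i <= k)%N -> (k < j <= b)%N -> D i j -> i = a /\ j = b.
Proof.
move=> Dc ltab.
pose P k := ((k == a) || D a k) && (a <= k < b)%N.
have exP : exists k, P k by exists a; rewrite /P eqxx leqnn ltab.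
have ubP k : P k -> (k <= b)%N by case/and3P=> _ _ /ltnW.
case: (ex_maxnP exP ubP) => k /andP[Dk kab] kmax.
exists k => // i j aik kjb Dij.
case: (eqVneq i a) => [ia|nia].
  split=> //; case: (eqVneq j b) => // njb.
  have : P j by rewrite /P -ia Dij orbT; lia.
  by move/kmax; lia.
exfalso; case/orP: Dk => [/eqP ka|Dak]; first lia.
by apply: (Dc a i k j) => //; lia.
Qed.

(* The strict quadrangle inequality with the convention [G i i = 0]; the case
   [j = k] is the strict triangle inequality. *)
Definition quadrangle (G : nat -> nat -> R) :=
  (forall i, G i i = 0) /\
  forall i j k l, (i < j <= k)%N -> (k < l < N)%N ->
    G i k + G j l < G i l + G j k.

Lemma quadrangle_le (G : nat -> nat -> R) i j k l :
  quadrangle G -> (i <= j <= k)%N -> (k <= l < N)%N ->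
  G i k + G j l <= G i l + G j k.
Proof.
move=> [_ HG] ijk kl.
case: (eqVneq i j) => [->|nij]; first by rewrite addrC.
case: (eqVneq k l) => [->//|nkl].
by apply/ltW/HG; lia.
Qed.

(** The last clause is connectedness of the graph of tight edges, phrased through functions constant
    along edges so that it feeds directly into linear algebra. *)
Lemma interval_solution (G : nat -> nat -> R) (D : nat -> nat -> bool) :
  quadrangle G -> compatible D ->
  forall a b, (a <= b < N)%N ->
  exists v : nat -> R,
    [/\ forall i j, (a <= i <= j)%N -> (j <= b)%N -> G i j <= v j - v i,
        forall i j, (a <= i < j)%N -> (j <= b)%N -> D i j -> v j - v i = G i j,
        v b - v a = G a b &
        forall u : nat -> R,
          (forall i j, (a <= i < j)%N -> (j <= b)%N ->
             v j - v i = G i j -> u i = u j) ->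
          forall i, (a <= i <= b)%N -> u i = u a].
Proof.
move=> HG Dc a b; have G0 := HG.1.
have [d] := ubnP (b - a); elim: d => // d IH in a b *.
move=> ltd /andP[leab ltbN].
case: (eqVneq a b) => [eab|neab].
  exists (fun=> 0); split.
  - by move=> i j Hi Hj; have -> : i = j; [lia|]; rewrite G0 subrr.
  - by move=> i j Hi Hj; lia.
  - by rewrite -eab G0 subrr.
  - by move=> u _ i Hi; congr u; lia.
have ltab : (a < b)%N by lia.
have [k kab ksplit] := compatible_split Dc ltab.
have [v1 [v1G v1D v1t v1c]] := IH a k ltac:(lia) ltac:(lia).
have [v2 [v2G v2D v2t v2c]] := IH k.+1 b ltac:(lia) ltac:(lia).
pose v i := if (i <= k)%N then v1 i - v1 a else v2 i - v2 b + G a b.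
have vL i : (i <= k)%N -> v i = v1 i - v1 a by rewrite /v => ->.
have vR i : (k < i)%N -> v i = v2 i - v2 b + G a b.
  by rewrite /v ltnNge => /negbTE->.
have vab : v b - v a = G a b.
  by rewrite (vL a) ?(vR b); first [lia|lra].
exists v; split=> //.
- move=> i j Hi Hj.
  case: (leqP j k) => jk; first by have := v1G i j Hi jk; rewrite !vL; first [lia|lra].
  case: (leqP i k) => ik; last first.
    by have := v2G i j ltac:(lia) Hj; rewrite !vR; first [lia|lra].
  rewrite (vL i) // (vR j) //.
  have A1 := v1G i k ltac:(lia) ltac:(lia).
  have A2 := v2G k.+1 j ltac:(lia) ltac:(lia).
  (* Starting from [G a b], the first inequality moves the left end from [a] to [i], the second
     moves the right end from [b] to [j]. *)
  have Q1 := @quadrangle_le G a i k b HG ltac:(lia) ltac:(lia).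
  have Q2 := @quadrangle_le G i k.+1 j b HG ltac:(lia) ltac:(lia).
  lra.
- move=> i j Hi Hj Dij.
  case: (leqP j k) => jk; first by have := v1D i j Hi jk Dij; rewrite !vL; first [lia|lra].
  case: (leqP i k) => ik; last first.
    by have := v2D i j ltac:(lia) Hj Dij; rewrite !vR; first [lia|lra].
  by have [-> ->] := ksplit i j ltac:(lia) ltac:(lia) Dij.
- move=> u Hu.
  have uL i : (a <= i <= k)%N -> u i = u a.
    apply: v1c => i' j' Hi' Hj' E; apply: Hu => //; first lia.
    by rewrite !vL; first [lia|lra].
  have uR i : (k.+1 <= i <= b)%N -> u i = u k.+1.
    apply: v2c => i' j' Hi' Hj' E; apply: Hu => //; first lia.
    by rewrite !vR; first [lia|lra].
  have uab : u a = u b by apply: Hu => //; lia.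
  move=> i Hi; case: (leqP i k) => ik; first by apply: uL; lia.
  by rewrite uR ?uab ?uR //; lia.
Qed.

(** Raising entries by [e] adds at most [2e] to the left side of a quadrangle inequality and does
    not lower the right side, so any [e] below half of each of the finitely many slacks works. *)
Lemma quadrangle_perturb (G : nat -> nat -> R) (D : nat -> nat -> bool) :
  quadrangle G -> exists2 e : R, 0 < e &
  quadrangle (fun i j => G i j + (if (i < j)%N && ~~ D i j then e else 0)).
Proof.
move=> [G0 HG].
pose I := ('I_N * 'I_N * 'I_N * 'I_N)%type.
pose P (x : I) := let: (i, j, k, l) := x in (i < j <= k)%N && (k < l)%N.
pose f (x : I) := let: (i, j, k, l) := x in
  (G i l + G j k - G i k - G j l) / 2.
have fpos x : P x -> 0 < f x.
  case: x => [[[i j] k] l] /andP[ijk kl].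
  have klN : (k < l < N)%N by rewrite kl ltn_ord.
  by have := HG i j k l ijk klN; rewrite /f; lra.
have [e e0 He] := finite_pos_lower_bound fpos.
exists e => //; split=> [i|i j k l ijk klN]; first by rewrite ltnn G0 addr0.
have Hl : (l < N)%N by lia.
have Hk : (k < N)%N by lia.
have Hj : (j < N)%N by lia.
have Hi : (i < N)%N by lia.
have := He (Ordinal Hi, Ordinal Hj, Ordinal Hk, Ordinal Hl).
rewrite /P /f /= ijk (_ : (k < l)%N); last lia.
move=> /(_ isT) {}He.
by do 4 case: ifP => _; lra.
Qed.

End Intervals.

(** * Compatible graphs as sets of tight edges *)

Section Polyhedron.
Variables (R : realType) (m : nat).
Local Notation n := m.+2.
Implicit Types (g : 'I_n -> 'I_n -> R) (D T : {set 'I_n * 'I_n}).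
Implicit Types (v w : 'rV[R]_n).

(** Natural indices suit the induction on intervals; the default [0] provides [G i i = 0]. *)
Definition nat_heights g (i j : nat) : R :=
  if (i < j)%N then g (inord i) (inord j) else 0.

Definition expansive g := quadrangle n (nat_heights g).

Definition compat D :=
  (forall i j : 'I_n, (i, j) \in D -> (i < j)%N) /\
  forall i j k l : 'I_n, (i, k) \in D -> (j, l) \in D ->
    (i < j <= k)%N -> (k < l)%N -> False.

(** This is connectedness of the graph [D] on all vertices, in the form of potentials. *)
Definition rigid D := forall u : 'I_n -> R,
  (forall i j, (i, j) \in D -> u i = u j) -> forall i, u i = u ord0.

(** The empty [D] gives [Xbar g] and [edge1n n] gives [Xg g], so both polyhedra can be treated at
    once. *)
Definition Fset g D : set 'rV[R]_n := [set v | Xbar g v /\ D \subset Eset g v].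

Lemma expansiveP g :
  (forall i j k l : 'I_n, (i < j)%N -> (j < k)%N -> (k < l)%N ->
     g i k + g j l < g i l + g j k) ->
  (forall i k l : 'I_n, (i < k)%N -> (k < l)%N -> g i k + g k l < g i l) ->
  expansive g.
Proof.
move=> H1 H2; split=> [i|i j k l ijk kl]; first by rewrite /nat_heights ltnn.
rewrite /nat_heights.
have ik : (i < k)%N by lia.
have jl : (j < l)%N by lia.
have il : (i < l)%N by lia.
rewrite ik jl il.
have inK x : (x <= l)%N -> nat_of_ord (inord x : 'I_n) = x.
  by move=> xl; rewrite inordK //; lia.
case: (ltnP j k) => jk.
  by apply: H1; rewrite !inK; lia.
have <- : k = j by lia.
by rewrite addr0; apply: H2; rewrite !inK; lia.
Qed.

Lemma Eset_edge g v i j : (i, j) \in Eset g v -> (i < j)%N.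
Proof. by rewrite inE => /andP[]. Qed.

Lemma EsetP g v (i j : 'I_n) :
  (i < j)%N -> reflect (v 0 j - v 0 i = g i j) ((i, j) \in Eset g v).
Proof. by move=> ij; rewrite inE /= ij; apply: eqP. Qed.

Lemma Eset_eq g v i j : (i, j) \in Eset g v -> v 0 j - v 0 i = g i j.
Proof. by rewrite inE => /andP[_ /eqP]. Qed.

Lemma tight_point g D : expansive g -> compat D ->
  exists v, [/\ Xbar g v, D \subset Eset g v,
    (ord0, ord_max) \in Eset g v & rigid (Eset g v)].
Proof.
move=> Hg [De Dc].
pose DN i j := [&& (i < n)%N, (j < n)%N & (inord i, inord j) \in D].
have DNc : compatible DN.
  move=> i j k l /and3P[Hi Hk Dik] /and3P[Hj Hl Djl] ijk kl.
  by apply: (Dc _ _ _ _ Dik Djl); rewrite !inordK.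
have [v [vG vD vt vc]] := interval_solution Hg DNc (a := 0) (b := m.+1) ltac:(lia).
pose w : 'rV[R]_n := \row_j (v j - v 0%N).
have wE (i j : 'I_n) : w 0 j - w 0 i = v j - v i by rewrite !mxE; lra.
have gE (i j : 'I_n) : (i < j)%N -> nat_heights g i j = g i j.
  by rewrite /nat_heights => ->; rewrite !inord_val.
have ltn (i : 'I_n) : (i <= m.+1)%N by rewrite -ltnS.
exists w; split.
- split=> [i i0|i j ij]; first by rewrite mxE i0 subrr.
  by rewrite wE -gE //; apply: vG => //; rewrite (ltnW ij).
- apply/fintype.subsetP => -[i j] Dij; have ij := De _ _ Dij.
  apply/EsetP => //; rewrite wE -gE //; apply: vD => //.
  by rewrite /DN !ltn_ord !inord_val.
- by apply/EsetP => //; rewrite wE -gE.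
move=> u Hu i.
have := vc (fun i => u (inord i)).
rewrite (_ : u i = u (inord i)); last by rewrite inord_val.
rewrite (_ : u ord0 = u (inord 0)); last by congr u; apply: val_inj; rewrite /= inordK.
apply; last by rewrite ltn.
move=> {}i j ij jm E; apply: Hu.
have Hi : (i < n)%N by lia.
have Hj : (j < n)%N by lia.
by apply/EsetP; rewrite ?wE !inordK // E /nat_heights; case/andP: ij => _ ->.
Qed.

Lemma perturbation g D : expansive g -> exists g' : 'I_n -> 'I_n -> R,
  [/\ expansive g', forall i j, (i, j) \in D -> g' i j = g i j &
      forall i j, (i, j) \notin D -> g i j < g' i j].
Proof.
move=> Hg.
have [e e0 He] := quadrangle_perturb (fun i j => (inord i, inord j) \in D) Hg.
exists (fun i j => g i j + (if (i, j) \in D then 0 else e)); split.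
- move: He; rewrite /expansive; congr (quadrangle _ _).
  apply/funext => i; apply/funext => j; rewrite /nat_heights.
  by case: ifP => //= _; [case: (_ \in D) | rewrite addr0].
- by move=> i j ->; rewrite addr0.
- by move=> i j /negbTE->; lra.
Qed.

Lemma Eset_surj g D : expansive g -> compat D ->
  exists2 v, Xbar g v & Eset g v = D.
Proof.
move=> Hg Dc.
have [g' [Hg' gD gnD]] := perturbation D Hg.
have [v [[v0 vX] vD _ _]] := tight_point Hg' Dc.
have gg' i j : g i j <= g' i j.
  by case: (boolP ((i, j) \in D)) => [/gD->//|/gnD/ltW].
exists v; first by split=> // i j ij; apply: le_trans (gg' i j) (vX i j ij).
apply/setP => -[i j]; apply/idP/idP => [Eij|Dij].
  have ij := Eset_edge Eij; apply: contraT => /gnD.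
  by have := vX i j ij; have := Eset_eq Eij; lra.
by apply/EsetP; [exact: Dc.1|rewrite -gD //; apply: Eset_eq; apply: (fintype.subsetP vD)].
Qed.

(** If [ik] and [jl] are both tight, regrouping gives [(v_l - v_i) + (v_k - v_j) = g i k + g j l],
    which is less than [g i l + g j k] and contradicts the constraints of [il] and [jk]; for [j = k]
    the second constraint reads [0 >= 0]. *)
Lemma Eset_compat g v : expansive g -> Xbar g v -> compat (Eset g v).
Proof.
move=> [_ Hg] [_ vX]; split=> [i j /Eset_edge//|i j k l Eik Ejl ijk kl].
have gE (x y : 'I_n) : (x < y)%N -> nat_heights g x y = g x y.
  by rewrite /nat_heights => ->; rewrite !inord_val.
have klN : (k < l < n)%N by rewrite kl ltn_ord.
have ik := Eset_edge Eik; have jl := Eset_edge Ejl.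
have il : (i < l)%N by lia.
have := Hg i j k l ijk klN; rewrite (gE i k) // (gE j l) // (gE i l) //.
have := Eset_eq Eik; have := Eset_eq Ejl; have := vX i l il.
rewrite /nat_heights; case: (ltnP j k) => jk.
  by have := vX j k jk; rewrite !inord_val; lra.
have -> : k = j; first by apply: ord_inj; lia.
by lra.
Qed.

(** The tight edges at the point of [tight_point] serve. This completes a compatible graph to a
    non-crossing alternating tree through [1n]. *)
Lemma rigid_extension g D : expansive g -> compat D ->
  exists T, [/\ D \subset T, compat T, (ord0, ord_max) \in T & rigid T].
Proof.
move=> Hg Dc; have [v [vX vD v1 vr]] := tight_point Hg Dc.
by exists (Eset g v); split=> //; apply: Eset_compat.
Qed.

Lemma compat_sub D T : D \subset T -> compat T -> compat D.
Proof.
move=> /fintype.subsetP DT [Te Tc]; split=> [i j /DT/Te//|i j k l /DT Dik /DT Djl].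
exact: Tc Dik Djl.
Qed.

End Polyhedron.

(** * Independence of the tight equations and dimension of the faces *)

(** If [d < d'], the first [d.+2] of [d'.+1] affinely independent points stay independent:
    truncating the columns of a right inverse for the larger family gives one for the smaller. *)
Lemma affdim_unique (R : realType) n (S : set 'rV[R]_n) d d' :
  affdim S d -> affdim S d' -> d = d'.
Proof.
wlog ltd : d d' / (d < d')%N.
  move=> H Sd Sd'; case: (ltngtP d d') => // lt; first exact: H lt Sd Sd'.
  by rewrite (H _ _ lt Sd' Sd).
move=> [_ Sd] [[p [Sp /row_freeP[B MB]]] _].
have le_d : (d.+2 <= d'.+1)%N by [].
case/negP: (Sd (p \o widen_ord le_d) (fun i => Sp _)).
have le_d' : (d.+1 <= d')%N by [].
apply/row_freeP; exists (\matrix_(j, i) B j (widen_ord le_d' i)).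
apply/matrixP => i j; rewrite !mxE.
move/matrixP/(_ (widen_ord le_d' i) (widen_ord le_d' j)): MB.
rewrite !mxE -val_eqE /= => <-.
apply: eq_bigr => k _; rewrite !mxE.
congr ((p _ 0 k - p _ 0 k) * _); apply: val_inj => //=.
Qed.

Section Dimension.
Variables (R : realType) (m : nat).
Local Notation n := m.+2.
Implicit Types (g : 'I_n -> 'I_n -> R) (D T : {set 'I_n * 'I_n}).
Implicit Types (v w : 'rV[R]_n) (e f : 'I_n * 'I_n).

Definition inc e w : R := w 0 e.2 - w 0 e.1.

Lemma sum_delta (x : 'I_n -> R) (i : 'I_n) :
  \sum_(j < n) x j * (i == j)%:R = x i.
Proof.
rewrite (bigD1 i) //= eqxx mulr1 big1 ?addr0 // => j.
by rewrite eq_sym => /negbTE->; rewrite mulr0.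
Qed.

Lemma sum_inc w e :
  \sum_(j < n) w 0 j * ((e.2 == j)%:R - (e.1 == j)%:R) = inc e w.
Proof.
under eq_bigr do rewrite mulrBr.
by rewrite sumrB !sum_delta.
Qed.

(** Let [V e] realize [T] without [e]. The difference [V e - v0], divided by its increment [c e]
    along [e], has increment [1] on [e] and [0] on the other edges of [T]. Such vectors are dual to
    the edges, so the equations of [T] are independent. *)
Lemma dual_frame g T : expansive g -> compat T ->
  exists v0 (c : 'I_n * 'I_n -> R) (U : 'I_n * 'I_n -> 'rV[R]_n),
  [/\ Xbar g v0, Eset g v0 = T,
    forall e, U e 0 ord0 = 0,
    forall e f, e \in T -> f \in T -> inc f (U e) = (e == f)%:R &
    forall e, e \in T ->
      [/\ c e != 0, Xbar g (v0 + c e *: U e) &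
          Eset g (v0 + c e *: U e) = T :\ e]].
Proof.
move=> Hg Tc.
have [v0 v0X v0T] := Eset_surj Hg Tc.
have /choice[V VP] : forall e, exists v, Xbar g v /\ Eset g v = T :\ e.
  move=> e; have [v] := Eset_surj Hg (compat_sub (subD1set T e) Tc).
  by exists v.
pose c e := inc e (V e) - inc e v0.
have c_neq0 e : e \in T -> c e != 0.
  move=> eT; rewrite subr_eq0; apply/negP => /eqP E.
  have : e \in T :\ e.
    case: e eT E => i j eT E; rewrite -(VP _).2; apply/EsetP; first exact: Tc.1.
    by rewrite -/(inc (i, j) _) E; apply: Eset_eq; rewrite v0T.
  by rewrite !inE eqxx.
have VE e : e \in T -> v0 + c e *: ((c e)^-1 *: (V e - v0)) = V e.
  by move=> /c_neq0 ce; rewrite scalerA divff // scale1r addrC subrK.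
exists v0, c, (fun e => (c e)^-1 *: (V e - v0)); split=> //.
- by move=> e; rewrite !mxE v0X.1 // (VP e).1.1 // subrr mulr0.
- move=> e f eT fT.
  have -> : inc f ((c e)^-1 *: (V e - v0)) = (c e)^-1 * (inc f (V e) - inc f v0).
    by rewrite /inc !mxE; lra.
  case: eqP => [<-|/eqP nef]; first by rewrite mulVf ?c_neq0.
  have fV : f \in Eset g (V e) by rewrite (VP e).2 !inE eq_sym nef.
  rewrite -v0T in fT; case: f {nef} fT fV => i j fT fV.
  by rewrite /inc /= (Eset_eq fT) (Eset_eq fV) subrr mulr0.
- by move=> e eT; rewrite VE //; have [] := VP e; split=> //; apply: c_neq0.
Qed.

(** The difference of the two sides has increment [0] along every edge of [T], so it is constant by
    rigidity, and it vanishes at [ord0]. *)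
Lemma rigid_decomposition T (U : 'I_n * 'I_n -> 'rV[R]_n) w :
  rigid R T -> (forall e, U e 0 ord0 = 0) ->
  (forall e f, e \in T -> f \in T -> inc f (U e) = (e == f)%:R) ->
  w 0 ord0 = 0 ->
  forall j, w 0 j = \sum_(e in T) inc e w * U e 0 j.
Proof.
move=> Tr U0 UT w0 j.
pose u j := w 0 j - \sum_(e in T) inc e w * U e 0 j.
suff : u j = 0 by move/eqP; rewrite subr_eq0 => /eqP.
have -> : u j = u ord0.
  apply: Tr => a b abT.
  apply/eqP; rewrite -subr_eq0 -oppr_eq0 opprB; apply/eqP.
  have -> : u b - u a =
      inc (a, b) w - \sum_(e in T) inc e w * inc (a, b) (U e).
    rewrite /u; under [in RHS]eq_bigr do rewrite mulrBr.
    by rewrite sumrB /inc /=; lra.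
  rewrite (bigD1 (a, b)) //= UT // eqxx mulr1 big1 ?addr0 ?subrr //.
  by move=> e /andP[eT /negbTE ne]; rewrite UT // ne mulr0.
rewrite /u w0 big1 ?subr0 // => e _; by rewrite U0 mulr0.
Qed.

(** With coordinate [ord0] dropped, the dual vectors and the incidence vectors of the edges form
    mutually inverse matrices: [AB = 1] is duality, and [BA = 1] is the decomposition of the unit
    vectors. Hence both are square. *)
Lemma card_rigid g T : expansive g -> compat T -> rigid R T -> #|T| = m.+1.
Proof.
move=> Hg Tc Tr.
have [v0 [c [U [_ _ U0 UT _]]]] := dual_frame Hg Tc.
pose A : 'M[R]_(#|T|, m.+1) := \matrix_(a, i) U (enum_val a) 0 (lift ord0 i).
pose B : 'M[R]_(m.+1, #|T|) := \matrix_(i, a)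
  (((enum_val a).2 == lift ord0 i)%:R - ((enum_val a).1 == lift ord0 i)%:R).
have AB : A *m B = 1%:M.
  apply/matrixP => a b; rewrite !mxE.
  rewrite -(inj_eq enum_val_inj) -UT ?enum_valP //.
  rewrite -sum_inc [in RHS]big_ord_recl U0 mul0r add0r.
  by apply: eq_bigr => i _; rewrite !mxE.
have BA : B *m A = 1%:M.
  apply/matrixP => i j; rewrite !mxE.
  pose w : 'rV[R]_n := \row_k (k == lift ord0 i)%:R.
  have w0 : w 0 ord0 = 0 by rewrite mxE.
  rewrite -[RHS](_ : w 0 (lift ord0 j) = _); last first.
    by rewrite mxE (inj_eq lift_inj) eq_sym.
  rewrite (rigid_decomposition Tr U0 UT w0) [RHS]big_enum_val.
  by apply: eq_bigr => a _; rewrite /inc !mxE.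
by apply/eqP; rewrite eqn_leq (mulmx1_min AB) (mulmx1_min BA).
Qed.

(** The points [v0] and [v0 + c e *: U e], for [e] in [T] outside [D], lie in the set and are
    affinely independent. Conversely a difference of two points of the set has no increment along
    [D], so it is a combination of the remaining [U e]. *)
Lemma affdim_Fset_rigid g D T : expansive g -> compat T -> rigid R T ->
  D \subset T -> affdim (Fset g D) #|T :\: D|.
Proof.
move=> Hg Tc Tr DT.
have [v0 [c [U [v0X v0T U0 UT UP]]]] := dual_frame Hg Tc.
set k := #|_|.
pose e (a : 'I_k) : 'I_n * 'I_n := enum_val a.
have eP a : e a \in T :\: D := enum_valP a.
have eT a : e a \in T by have := eP a; rewrite inE => /andP[].
have eD a : e a \notin D by have := eP a; rewrite inE => /andP[].
split.
  pose p (i : 'I_k.+1) :=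
    if unlift ord0 i is Some a then v0 + c (e a) *: U (e a) else v0.
  exists p; split.
    move=> i; rewrite /p; case: unliftP => [a _|_]; last by split; rewrite ?v0T.
    have [_ VX VT] := UP _ (eT a); split=> //.
    by rewrite VT subsetD1 DT eD.
  have p0 : p ord0 = v0 by rewrite /p unlift_none.
  have pS a : p (lift ord0 a) = v0 + c (e a) *: U (e a) by rewrite /p liftK.
  (* The right inverse consists of the incidence vectors, rescaled to undo the factors [c e]. *)
  apply/row_freeP; exists (\matrix_(j, b)
    ((c (e b))^-1 * (((e b).2 == j)%:R - ((e b).1 == j)%:R))).
  apply/matrixP => a b; rewrite !mxE.
  transitivity (c (e a) * (c (e b))^-1 * inc (e b) (U (e a))).
    rewrite -sum_inc mulr_sumr; apply: eq_bigr => j _.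
    rewrite !mxE p0 pS !mxE [v0 _ _ + _]addrC addrK mulrACA mulrA.
    by rewrite -!mulrA.
  rewrite UT // (inj_eq enum_val_inj); case: eqP => [->|_]; last by rewrite mulr0.
  by have [ce _ _] := UP _ (eT b); rewrite divff // mul1r.
move=> p pD; apply/negP => /eqP rkM.
set M := (M in \rank M) in rkM.
pose C := \matrix_(i < k.+1, a < k) inc (e a) (p (lift ord0 i) - p ord0).
(* Factoring through [k] columns bounds the rank by [k], whereas independence would make it
   [k.+1]. *)
suff ME : M = C *m (\matrix_(a, j) U (e a) 0 j).
  have := leq_trans (mxrankM_maxl C _) (rank_leq_col C).
  by move=> /(_ _ (\matrix_(a, j) U (e a) 0 j)); rewrite -ME rkM ltnn.
apply/matrixP => i j; rewrite !mxE.
pose w := p (lift ord0 i) - p ord0.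
have w0 : w 0 ord0 = 0 by rewrite !mxE !(pD _).1.1 // subrr.
transitivity (w 0 j); first by rewrite !mxE.
rewrite (rigid_decomposition Tr U0 UT w0).
rewrite (bigID (mem D)) /= big1 ?add0r; last first.
  case=> a b /andP[_ abD].
  have pab x : p x 0 b - p x 0 a = g a b.
    by apply: Eset_eq; apply: (fintype.subsetP (pD x).2).
  have := pab ord0; have := pab (lift ord0 i) => E1 E2.
  have -> : inc (a, b) w = 0 by rewrite /inc !mxE /=; lra.
  by rewrite mul0r.
rewrite (eq_bigl (mem (T :\: D))); last by move=> x; rewrite !inE andbC.
by rewrite [LHS]big_enum_val; apply: eq_bigr => a _; rewrite !mxE.
Qed.

Lemma affdim_Fset g D : expansive g -> compat D ->
  (#|D| <= m.+1)%N /\ affdim (Fset g D) (m.+1 - #|D|).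
Proof.
move=> Hg Dc; have [T [DT Tc _ Tr]] := rigid_extension Hg Dc.
have cT := card_rigid Hg Tc Tr.
have := affdim_Fset_rigid Hg Tc Tr DT.
rewrite cardsD (finset.setIidPr DT) cT; split=> //.
by apply: leq_trans (subset_leq_card DT) _; rewrite cT.
Qed.

End Dimension.

(** * Faces and vertices in terms of tight edges *)

Section Faces.
Variables (R : realType) (m : nat).
Local Notation n := m.+2.
Implicit Types (g : 'I_n -> 'I_n -> R) (B D T : {set 'I_n * 'I_n}).
Implicit Types (u v w x y : 'rV[R]_n) (e : 'I_n * 'I_n).

Lemma edge1nE : edge1n n = [set (ord0, ord_max)]%SET.
Proof.
apply/setP => -[i j]; rewrite !inE xpair_eqE -!val_eqE /=.
by [].
Qed.

Lemma Fset_set0 g : Fset g finset.set0 = Xbar g.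
Proof. by apply/seteqP; split=> v; [case|split; rewrite ?finset.sub0set]. Qed.

Lemma Fset_edge1n g : Fset g (edge1n n) = Xg g.
Proof.
rewrite edge1nE; apply/seteqP; split=> v [vX].
  rewrite finset.sub1set => /Eset_eq E; split=> // i j i0 jn.
  have -> : i = ord0 by apply: ord_inj.
  by have -> : j = ord_max by apply: ord_inj.
by move=> H; split=> //; rewrite finset.sub1set; apply/EsetP => //; apply: H.
Qed.

Lemma Fset_sub g D D' : D \subset D' -> Fset g D' `<=` Fset g D.
Proof. by move=> DD' v [vX vD]; split=> //; apply: fintype.subset_trans vD. Qed.

Lemma Fset_le g D D' : expansive g -> compat D' ->
  Fset g D' `<=` Fset g D -> D \subset D'.
Proof.
move=> Hg Dc; have [v vX vD] := Eset_surj Hg Dc.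
by move=> /(_ v)[|_]; [split=> //; rewrite vD | rewrite vD].
Qed.

Lemma Fset_inj g D D' : expansive g -> compat D -> compat D' ->
  Fset g D = Fset g D' -> D = D'.
Proof.
move=> Hg Dc Dc' E; apply/eqP; rewrite finset.eqEsubset.
by apply/andP; split; apply: (Fset_le Hg) => //; rewrite E.
Qed.

Lemma Eface_Fset g D : expansive g -> compat D -> Eface g (Fset g D) = D.
Proof.
move=> Hg Dc; apply/setP => -[i j]; rewrite inE /=; apply/idP/idP.
  case/andP=> ij /asboolP H; have [v vX vD] := Eset_surj Hg Dc.
  by rewrite -vD; apply/EsetP => //; apply: H; split; rewrite ?vD.
move=> Dij; rewrite (Dc.1 _ _ Dij); apply/asboolP => v [_ vD].
by apply: Eset_eq; apply: (fintype.subsetP vD).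
Qed.

Lemma dotv_ray c x y (t : R) :
  dotv c (x + t *: (x - y)) = dotv c x + t * (dotv c x - dotv c y).
Proof.
rewrite /dotv -sumrB mulr_sumr -big_split /=; apply: eq_bigr => j _.
by rewrite !mxE; lra.
Qed.

(** Summing the constraints of the edges in [D] gives a valid inequality. Its gap is a sum of
    nonnegative slacks, which vanishes only if every edge of [D] is tight. *)
Lemma Fset_face g B D : B \subset D ->
  (forall i j, (i, j) \in D -> (i < j)%N) -> face (Fset g B) (Fset g D).
Proof.
move=> BD De.
pose c : 'rV[R]_n := \row_k \sum_(e in D) ((e.1 == k)%:R - (e.2 == k)%:R).
have cE x : dotv c x = - \sum_(e in D) inc e x.
  rewrite -sumrN /dotv; under eq_bigr do rewrite mxE mulr_suml.
  rewrite exchange_big; apply: eq_bigr => e _.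
  rewrite -sum_inc -sumrN; apply: eq_bigr => j _.
  by rewrite mulrC -mulrN opprB.
have ge0 x : Xbar g x -> forall e, e \in D -> 0 <= inc e x - g e.1 e.2.
  by move=> xX [i j] /De ij; rewrite subr_ge0; apply: xX.2.
have dE x : - \sum_(e in D) g e.1 e.2 - dotv c x =
    \sum_(e in D) (inc e x - g e.1 e.2).
  by rewrite cE opprK [RHS]sumrB addrC.
exists c, (- \sum_(e in D) g e.1 e.2); split.
  by move=> x [xX _]; rewrite -subr_ge0 dE; apply: sumr_ge0; apply: ge0.
apply/seteqP; split=> x.
  move=> xD; split; first exact: Fset_sub xD.
  apply/eqP; rewrite eq_sym -subr_eq0 dE; apply/eqP/big1 => -[i j] Dij.
  by rewrite /inc (Eset_eq (fintype.subsetP xD.2 _ Dij)) subrr.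
case=> -[xX xB] /eqP; rewrite eq_sym -subr_eq0 dE => /eqP /psumr_eq0P H.
split=> //; apply/fintype.subsetP => -[i j] Dij; apply/EsetP; first exact: De.
by apply/eqP; rewrite -subr_eq0; apply/eqP; apply: (H (ge0 x xX)) Dij.
Qed.

Lemma Eset_midpoint g x y : Xbar g x -> Xbar g y ->
  Xbar g (2^-1 *: (x + y)) /\
  Eset g (2^-1 *: (x + y)) = Eset g x :&: Eset g y.
Proof.
move=> [x0 xX] [y0 yX]; set z := _ *: _.
have zE i j : z 0 j - z 0 i =
    ((x 0 j - x 0 i) + (y 0 j - y 0 i)) / 2 by rewrite !mxE; lra.
split.
  split=> [i i0|i j ij]; first by rewrite !mxE x0 // y0 // addr0 mulr0.
  by rewrite zE; have := xX i j ij; have := yX i j ij; lra.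
apply/setP => -[i j]; rewrite !inE /= zE; case: ltnP => //= ij.
have := xX i j ij; have := yX i j ij => y1 x1.
apply/eqP/andP => [E|[/eqP-> /eqP->]]; last by lra.
by split; apply/eqP; lra.
Qed.

Lemma dotv_midpoint c x y :
  dotv c (2^-1 *: (x + y)) = (dotv c x + dotv c y) / 2.
Proof.
rewrite /dotv -big_split mulr_suml; apply: eq_bigr => j _ /=.
by rewrite !mxE; lra.
Qed.

(* [x] minimizes [#|Eset g x|] over the face, so it lies in the relative
   interior: any [y] satisfying the same equations can be reflected slightly
   beyond [x] inside the polyhedron, which puts [y] on the supporting
   hyperplane. *)
Lemma face_Fset g B F : face (Fset g B) F -> F !=set0 ->
  exists x, F x /\ F = Fset g (Eset g x).
Proof.
move=> [c [d [cd FE]]] [x1 Fx1].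
pose P k := `[< exists x, F x /\ #|Eset g x| = k >].
have exP : exists k, P k by exists #|Eset g x1|; apply/asboolP; exists x1.
case: (ex_minnP exP) => _ /asboolP[x [Fx <-]] xmin.
have xle y : F y -> Eset g x \subset Eset g y.
  move=> Fy.
  have [[[xX xB] cx] [[yX yB] cy]] : (Fset g B x /\ dotv c x = d) /\
      (Fset g B y /\ dotv c y = d) by move: Fx Fy; rewrite FE.
  have [zX zE] := Eset_midpoint xX yX.
  have : (#|Eset g x| <= #|Eset g x :&: Eset g y|)%N.
    apply: xmin; apply/asboolP; exists (2^-1 *: (x + y)); rewrite zE FE.
    split=> //; split; last by rewrite dotv_midpoint cx cy; lra.
    by split; rewrite ?zE ?finset.subsetI ?xB.
  move=> le; have := finset.subsetIl (Eset g x) (Eset g y).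
  rewrite subEproper => /orP[/eqP <-|/proper_card]; first exact: finset.subsetIr.
  by rewrite ltnNge le.
exists x; split=> //; apply/seteqP; split=> y.
  by move=> Fy; split; [move: Fy; rewrite FE => -[[]] | apply: xle].
move=> [yX yx].
have [[xX xB] cx] : Fset g B x /\ dotv c x = d by move: Fx; rewrite FE.
have yB : Fset g B y by split=> //; apply: fintype.subset_trans yx.
pose s e z := inc e z - g e.1 e.2.
have s_ge0 e z : Xbar g z -> (e.1 < e.2)%N -> 0 <= s e z.
  by move=> zX ij; rewrite subr_ge0; apply: zX.2.
pose Q e := (e.1 < e.2)%N && (e \notin Eset g x).
(* The bound yields [t * s e y < s e x], which keeps the slack at [z] nonnegative; the summand [1]
   prevents division by zero. *)
have [t t0 Ht] : exists2 t : R, 0 < t &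
    forall e, Q e -> t < s e x / (1 + s e y).
  apply: finite_pos_lower_bound => -[i j] /andP[ij Ex].
  have sy := s_ge0 (i, j) y yX ij; have sx := s_ge0 (i, j) x xX ij.
  apply: divr_gt0; last by lra.
  rewrite lt_def sx andbT subr_eq0; apply: contra Ex => /eqP E.
  exact/EsetP.
pose z := x + t *: (x - y).
have zs e : s e z = s e x + t * (s e x - s e y) by rewrite /s /inc !mxE; lra.
have zE e : e \in Eset g x -> s e z = 0.
  case: e => i j Ex; rewrite zs /s /inc (Eset_eq Ex).
  by rewrite (Eset_eq (fintype.subsetP yx _ Ex)); lra.
have zX : Xbar g z.
  split=> [i i0|i j ij].
    by rewrite !mxE xX.1 // yX.1 //; lra.
  rewrite -subr_ge0; change (0 <= s (i, j) z).
  case: (boolP ((i, j) \in Eset g x)) => [/zE->//|Ex].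
  have := Ht (i, j); rewrite /Q ij Ex => /(_ isT).
  have sy := s_ge0 (i, j) y yX ij; have sx := s_ge0 (i, j) x xX ij.
  rewrite ltr_pdivlMr; last by lra.
  rewrite zs => H; have : 0 <= t * s (i, j) x by apply: mulr_ge0 => //; apply: ltW.
  lra.
have zB : Fset g B z.
  split=> //; apply/fintype.subsetP => -[i j] Bij.
  have Ex := fintype.subsetP xB _ Bij.
  apply/EsetP; first exact: Eset_edge Ex.
  by have := zE _ Ex; rewrite /s /inc /=; lra.
rewrite FE; split=> //; apply/eqP; rewrite eq_le cd //=.
have := cd _ zB; rewrite dotv_ray cx.
rewrite -subr_ge0 opprD addrA subrr sub0r oppr_ge0 pmulr_rle0 // subr_le0.
by [].
Qed.

Lemma Fset_rigid g D v w : rigid R D -> Fset g D v -> Fset g D w -> v = w.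
Proof.
move=> Dr [vX vD] [wX wD]; apply/rowP => j.
apply/eqP; rewrite -subr_eq0; apply/eqP.
rewrite (Dr (fun j => v 0 j - w 0 j)) => [|a b Dab].
  by rewrite vX.1 // wX.1 // subrr.
have := Eset_eq (fintype.subsetP vD _ Dab).
have := Eset_eq (fintype.subsetP wD _ Dab).
lra.
Qed.

(** Connectedness gives rigidity because the level set of [u] through [ord0] is closed under
    adjacency. Rigidity gives connectedness when tested on the indicator of the component of [ord0];
    the edge count is [card_rigid]. *)
Lemma nc_alt_treeP g T : expansive g -> nc_alt_tree T <-> compat T /\ rigid R T.
Proof.
move=> Hg; split.
  case/and3P => /and3P[/forall_inP Te /forallP Tc _] /forallP Ta /forallP Tn.
  split; first split.
  - by move=> i j /Te.
  - move=> i j k l Tik Tjl /andP[ij jk] kl.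
    case: (eqVneq j k) => [jk'|njk].
      have /forallP/(_ j)/forallP/(_ l) := Ta i.
      have Tij : (i, j) \in T by rewrite jk'.
      have jl : (j < l)%N by rewrite jk'.
      by rewrite Tij Tjl ij jl.
    have /forallP/(_ j)/forallP/(_ k)/forallP/(_ l) := Tn i.
    by rewrite Tik Tjl ij kl ltn_neqAle val_eqE njk jk.
  - move=> u Hu i.
    have /forallP/(_ i)/closed_connect := Tc ord0.
    move=> /(_ [pred j | u j == u ord0]); rewrite !inE eqxx => H.
    apply/eqP; rewrite -H // => x y; rewrite !inE => /orP[] /Hu; last by move->.
    by move->.
move=> [Tc Tr]; apply/and3P; split; first (apply/and3P; split).
- by apply/forall_inP => -[i j] /Tc.1.
- have sT : connect_sym (adjrel T).
    by apply: sym_connect_sym => x y; rewrite /adjrel orbC.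
  have H i : connect (adjrel T) ord0 i.
    have := Tr (fun i => (connect (adjrel T) ord0 i)%:R).
    move=> /(_ _ i); rewrite connect0 => H.
    have /eqP : (connect (adjrel T) ord0 i)%:R = 1 :> R.
      apply: H => x y Txy; congr (_%:R); congr nat_of_bool.
      apply: same_connect_r => //; apply: connect1.
      by rewrite /adjrel Txy.
    by case: connect => //; rewrite eq_sym oner_eq0.
  apply/forallP => i; apply/forallP => j.
  by apply: connect_trans (H j); rewrite sT.
- by rewrite (card_rigid Hg Tc Tr).
- apply/forallP => i; apply/forallP => j; apply/forallP => k.
  apply/negP => /and4P[Tij Tjk ij jk].
  by apply: (Tc.2 _ _ _ _ Tij Tjk) => //; rewrite ij /=.
- apply/forallP => i; apply/forallP => j; apply/forallP => k; apply/forallP => l.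
  apply/negP => /and5P[Tij Tjk ij jk kl].
  by apply: (Tc.2 _ _ _ _ Tij Tjk) => //; rewrite ij ltnW.
Qed.

(** The rigid extension of [T] containing [1n] has as many edges as [T], hence equals [T]. *)
Lemma edge1n_tree g T : expansive g -> compat T -> rigid R T -> edge1n n \subset T.
Proof.
move=> Hg Tc Tr; rewrite edge1nE finset.sub1set.
have [T' [TT' Tc' e1n Tr']] := rigid_extension Hg Tc.
suff /eqP -> : T == T' by [].
by rewrite eqEcard TT' (card_rigid Hg Tc Tr) (card_rigid Hg Tc' Tr') leqnn.
Qed.

(** A point realizing a tree that extends [E(v)] lies in the face [[set v]], hence is [v]. As the
    criterion does not mention [B], the two polyhedra have the same vertices. *)
Lemma vertexP g B v : expansive g -> B \subset edge1n n ->
  vertex (Fset g B) v <-> Xbar g v /\ nc_alt_tree (Eset g v).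
Proof.
move=> Hg B1; split.
  move=> /face_Fset[|x [-> E]]; first by exists v.
  have [vX vE] : Fset g (Eset g v) v by rewrite -E.
  split=> //; have vc := Eset_compat Hg vX; apply/(nc_alt_treeP _ Hg); split=> //.
  have [T [vT Tc _ Tr]] := rigid_extension Hg vc.
  have [y yX yT] := Eset_surj Hg Tc.
  have : Fset g (Eset g v) y by split; rewrite ?yT.
  by rewrite -E => <-; rewrite yT.
move=> [vX /(nc_alt_treeP _ Hg)[vc vr]].
rewrite /vertex (_ : [set v] = Fset g (Eset g v)).
  apply: Fset_face; last by move=> i j /Eset_edge.
  by apply: fintype.subset_trans B1 (edge1n_tree Hg vc vr).
apply/seteqP; split=> [_ ->|w wE] /=; first by split.
by apply: Fset_rigid vr wE _; split.
Qed.

End Faces.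

(** * Boundedness, adjacency, facets and extreme rays *)

Lemma ray_unbounded (R : realType) n (S : set 'rV[R]_n)
    (v w : 'rV[R]_n) j :
  w 0 j = 1 -> (forall t : R, 0 <= t -> S (v + t *: w)) -> ~ bounded S.
Proof.
move=> wj Sray [M SM].
have t0 : 0 <= `|M| + `|v 0 j| + 1 by rewrite !addr_ge0.
have := SM _ (Sray _ t0) j.
rewrite !mxE wj mulr1.
have := ler_norm M; have := ler_norm (- v 0 j); rewrite normrN.
move=> H1 H2 /(le_trans (ler_norm _)).
lra.
Qed.

Section Main.
Variables (R : realType) (m : nat).
Local Notation n := m.+2.
Implicit Types (g : 'I_n -> 'I_n -> R) (B D T : {set 'I_n * 'I_n}).
Implicit Types (u v w : 'rV[R]_n) (e : 'I_n * 'I_n).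

Lemma compat_edge1nU D : compat D -> compat (edge1n n :|: D).
Proof.
rewrite edge1nE => -[De Dc]; split=> [i j|i j k l].
  by rewrite !inE => /orP[/eqP[-> ->]|/De].
rewrite !inE => /orP[/eqP[-> ->]|Dik] /orP[/eqP[-> ->]|Djl] // ijk kl.
- by have := ltn_ord l; move: kl => /=; lia.
- exact: Dc Dik Djl ijk kl.
Qed.

Lemma compat_edge1n : compat (edge1n n).
Proof.
have -> : edge1n n = (edge1n n :|: finset.set0) by rewrite finset.setU0.
by apply: compat_edge1nU; split=> [i j|i j k l]; rewrite inE.
Qed.

Lemma card_edge1n : #|edge1n n| = 1%N.
Proof. by rewrite edge1nE cards1. Qed.

Lemma Xg_bounded g : bounded (Xg g).
Proof.
(* Each coordinate lies between [g ord0 j] and [g ord0 ord_max - g j ord_max] (for [j] other than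
   the two ends); the constant is a crude common bound. *)
exists (\sum_(i < n) \sum_(j < n) (`|g i j|) + `|g ord0 ord_max|) => v vX j.
have [[v0 vX'] v1] := vX.
have v00 := v0 ord0 erefl.
have := v1 ord0 ord_max erefl erefl; rewrite v00 subr0 => vn.
have le i k : `|g i k| <= \sum_(i < n) \sum_(j < n) `|g i j|.
  rewrite (bigD1 i) //= (bigD1 k) //= -addrA ler_wpDr // addr_ge0 //.
    by apply: sumr_ge0.
  by apply: sumr_ge0 => a _; apply: sumr_ge0.
have L := le ord0 j; have U := le j ord_max.
have := ler_norm (- g ord0 j); have := ler_norm (- g j ord_max).
have := ler_norm (g ord0 ord_max); rewrite !normrN => N1 N2 N3.
have P0 := normr_ge0 (g ord0 ord_max).
have P1 := normr_ge0 (g ord0 j).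
rewrite ler_norml; apply/andP; split.
  case: (eqVneq j ord0) => [->|nj]; first by rewrite v00; lra.
  have := vX' ord0 j; rewrite v00 subr0 lt0n => /(_ nj); lra.
case: (eqVneq j ord_max) => [->|nj]; first by rewrite vn; lra.
have jm : (j < m.+1)%N.
  have := ltn_ord j; rewrite ltnS leq_eqVlt => /orP[/eqP E|//].
  by case/eqP: nj; apply: ord_inj.
by have := vX' j ord_max jm; rewrite vn; lra.
Qed.

Lemma tree_exists g : expansive g ->
  exists2 T : {set 'I_n * 'I_n}, compat T & rigid R T.
Proof.
move=> Hg; have [T [_ Tc _ Tr]] := rigid_extension Hg (@compat_edge1n).
by exists T.
Qed.

(* Without [1n] the tree splits into components on [{1..k}] and [{k+1..n}];
   translating the second one upwards is a recession direction. *)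
Lemma Fset_unbounded g T : expansive g -> compat T ->
  ~ bounded (Fset g (T :\: edge1n n)).
Proof.
move=> Hg Tc; have [v vX vT] := Eset_surj Hg Tc.
pose TN i j := [&& (i < n)%N, (j < n)%N & (inord i, inord j) \in T].
have TNc : compatible TN.
  move=> i j k l /and3P[Hi Hk Tik] /and3P[Hj Hl Tjl] ijk kl.
  by apply: (Tc.2 _ _ _ _ Tik Tjl); rewrite !inordK.
have [k km ksplit] := compatible_split TNc (isT : (0 < m.+1)%N).
pose w : 'rV[R]_n := \row_j (k < j)%:R.
apply: (@ray_unbounded _ _ _ v w ord_max) => [|t t0].
  by rewrite mxE /=; case/andP: km => _ ->.
have incE (i j : 'I_n) : (v + t *: w) 0 j - (v + t *: w) 0 i =
    v 0 j - v 0 i + t * ((k < j)%:R - (k < i)%:R) by rewrite !mxE; lra.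
split.
  split=> [i i0|i j ij]; first by rewrite !mxE vX.1 // i0 ltn0 mulr0 addr0.
  rewrite incE; apply: (le_trans (vX.2 i j ij)).
  rewrite lerDl mulr_ge0 // subr_ge0 ler_nat.
  case: (ltnP k i) => // ki; by rewrite (ltn_trans ki ij).
apply/fintype.subsetP => -[i j]; rewrite inE => /andP[Nij Tij].
have ij := Tc.1 _ _ Tij.
apply/EsetP => //; rewrite incE -[RHS](@Eset_eq _ _ g v) ?vT //.
suff -> : (k < j)%N = (k < i)%N by rewrite subrr mulr0 addr0.
apply/idP/idP => [kj|ki]; last exact: ltn_trans ij.
rewrite ltnNge; apply: contra Nij => ik.
have [|||i0 jm] := ksplit i j; rewrite ?ik //.
- by rewrite kj -ltnS /=.
- by rewrite /TN !ltn_ord !inord_val.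
by rewrite edge1nE inE; apply/eqP; congr pair; apply: ord_inj.
Qed.

Lemma Xbar_unbounded g : expansive g -> ~ bounded (Xbar g).
Proof.
move=> Hg [M XM]; have [T Tc _] := tree_exists Hg.
by apply: (Fset_unbounded Hg Tc); exists M => v [vX _]; apply: XM.
Qed.

Lemma tree_vertex g B T : expansive g -> B \subset edge1n n -> nc_alt_tree T ->
  exists v, vertex (Fset g B) v /\ Eset g v = T.
Proof.
move=> Hg B1 Tt; have [Tc Tr] := (nc_alt_treeP T Hg).1 Tt.
have [v vX vT] := Eset_surj Hg Tc.
by exists v; split=> //; apply/vertexP => //; rewrite vT.
Qed.

Lemma Eset_inj g u v : expansive g -> Xbar g u -> Xbar g v ->
  nc_alt_tree (Eset g v) -> Eset g u = Eset g v -> u = v.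
Proof.
move=> Hg uX vX /(nc_alt_treeP _ Hg)[_ vr] uv.
by apply: (Fset_rigid (g := g) vr); split; rewrite ?uv.
Qed.

Lemma card_tree g T : expansive g -> nc_alt_tree T -> #|T| = m.+1.
Proof. by move=> Hg /(nc_alt_treeP _ Hg)[Tc Tr]; apply: (card_rigid Hg). Qed.

Lemma tree_edge1n g T : expansive g -> nc_alt_tree T -> edge1n n \subset T.
Proof. by move=> Hg /(nc_alt_treeP _ Hg)[Tc Tr]; apply: (edge1n_tree Hg). Qed.

Lemma affdim_card g D d : expansive g -> compat D ->
  affdim (Fset g D) d <-> (#|D| + d = m.+1)%N.
Proof.
move=> Hg Dc; have [leD dimD] := affdim_Fset Hg Dc; split=> [H|H].
  by rewrite (affdim_unique H dimD) subnKC.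
by have <- : (m.+1 - #|D|)%N = d; [lia | ].
Qed.

(** A one-dimensional face has [m] tight edges, all common to the two trees. Distinct trees with
    [m.+1] edges share at most [m], so they differ in one edge. Conversely the common edges define
    the required face. *)
Lemma adjacent_tree g u v : expansive g ->
  vertex (Fset g (edge1n n)) u -> vertex (Fset g (edge1n n)) v ->
  (adjacent (Fset g (edge1n n)) u v <-> #|Eset g u :\: Eset g v| = 1%N).
Proof.
move=> Hg /(vertexP _ Hg (fintype.subxx _))[uX ut].
move=> /(vertexP _ Hg (fintype.subxx _))[vX vt].
have cu := card_tree Hg ut; have cv := card_tree Hg vt.
have cD := cardsD (Eset g u) (Eset g v).
have cI := subset_leq_card (finset.subsetIl (Eset g u) (Eset g v)).
have uc := Eset_compat Hg uX.
split.
  move=> [uv [F [Ff [F1 [Fu Fv]]]]].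
  have [|x [Fx FE]] := face_Fset Ff; first by exists u.
  rewrite FE in Ff F1 Fu Fv.
  have xX : Xbar g x.
    by have [c [d [_ E]]] := Ff; move: Fx; rewrite FE E => -[[]].
  have := (affdim_card 1 Hg (Eset_compat Hg xX)).1 F1.
  have : Eset g x \subset Eset g u :&: Eset g v.
    by rewrite finset.subsetI Fu.2 Fv.2.
  move=> /subset_leq_card le cx.
  have : #|Eset g u :\: Eset g v| != 0%N.
    rewrite cards_eq0 finset.setD_eq0; apply/negP => sub.
    case/eqP: uv; apply: (Eset_inj Hg uX vX vt).
    by apply/eqP; rewrite eqEcard sub cu cv leqnn.
  rewrite cD cu; lia.
move=> c1; split.
  by apply/eqP => uv; move: c1; rewrite uv finset.setDv cards0.
have Dc : compat (Eset g u :&: Eset g v).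
  exact: compat_sub (finset.subsetIl _ _) uc.
exists (Fset g (Eset g u :&: Eset g v)); split; last split.
- apply: Fset_face; last exact: Dc.1.
  by rewrite finset.subsetI !(tree_edge1n Hg).
- apply/affdim_card => //; move: c1; rewrite cD cu; move: cI; rewrite cu.
  by move=> cI c1; lia.
- by split; split=> //; [apply: finset.subsetIl | apply: finset.subsetIr].
Qed.

(** A facet through [v] is given by [1n] and one further edge of the tree [E(v)], which leaves [m]
    choices. *)
Lemma facets_at_vertex g v : expansive g -> vertex (Fset g (edge1n n)) v ->
  exactly_k [set F | facet (Fset g (edge1n n)) F /\ F v] m.
Proof.
move=> Hg /(vertexP _ Hg (fintype.subxx _))[vX vt].
have cv := card_tree Hg vt; have v1 := tree_edge1n Hg vt.
have vc := Eset_compat Hg vX.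
have cE : #|Eset g v :\: edge1n n| = m.
  by rewrite cardsD (finset.setIidPr v1) cv card_edge1n subn1.
rewrite -[X in exactly_k _ X]cE; set k := #|_|; have km : k = m := cE.
pose h (a : 'I_k) : 'I_n * 'I_n := enum_val a.
pose f (a : 'I_k) := edge1n n :|: [set h a]%SET.
have fE a : (h a \in Eset g v) && (h a \notin edge1n n).
  by have : h a \in Eset g v :\: edge1n n := enum_valP a; rewrite finset.in_setD andbC.
have fv a : f a \subset Eset g v.
  by case/andP: (fE a) => av _; rewrite finset.subUset v1 finset.sub1set.
have fc a : compat (f a) := compat_sub (fv a) vc.
have cf a : #|f a| = 2%N.
  case/andP: (fE a) => _ an.
  by rewrite /f finset.setUC cardsU1 an card_edge1n.
exists (fun a => Fset g (f a)); split; last split.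
- move=> a b /(Fset_inj Hg (fc a) (fc b)) fab.
  have : h a \in f b by rewrite -fab !inE eqxx orbT.
  rewrite inE (negbTE (proj2 (andP (fE a)))) inE => /eqP.
  exact: enum_val_inj.
- move=> a; split; last by split.
  split; first by apply: Fset_face (fc a).1; apply: finset.subsetUl.
  split; first by exists v; split.
  have k0 : (0 < k)%N by apply: leq_ltn_trans (ltn_ord a).
  exists k.-1; split; apply/affdim_card => //; first exact: compat_edge1n.
    by rewrite prednK // card_edge1n km.
  by rewrite cf; lia.
- move=> F [[Ff [F0 [d [d1 d2]]]] Fv].
  have [x [Fx FE]] := face_Fset Ff F0.
  have [xX x1] : Fset g (edge1n n) x.
    by have [c [d' [_ E]]] := Ff; move: Fx; rewrite E => -[].
  rewrite FE in d2 Fv *.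
  move/(affdim_card _ Hg compat_edge1n): d1; rewrite card_edge1n => d1.
  move/(affdim_card _ Hg (Eset_compat Hg xX)): d2 => d2.
  have /eqP/cards1P[e xe] : #|Eset g x :\: edge1n n| = 1%N.
    by rewrite cardsD (finset.setIidPr x1) card_edge1n; lia.
  have xE : Eset g x = edge1n n :|: [set e]%SET.
    apply/setP => p; rewrite finset.in_setU -xe finset.in_setD.
    by case: (boolP (p \in edge1n n)) => // /(fintype.subsetP x1) ->.
  have ev : e \in Eset g v :\: edge1n n.
    have : e \in Eset g x :\: edge1n n by rewrite xe inE.
    by rewrite !(finset.in_setD) => /andP[-> /(fintype.subsetP Fv.2)].
  exists (enum_rank_in ev e).
  by rewrite /f /h enum_rankK_in // xE.
Qed.

(** On an unbounded face [1n] is not tight, since [Xg g] is bounded. A one-dimensional face has [m]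
    tight edges, so these are all the edges but [1n] of a tree extending them. *)
Lemma ext_ray_tree g F : expansive g -> ext_ray (Xbar g) F ->
  exists2 T, nc_alt_tree T & F = Fset g (T :\: edge1n n).
Proof.
move=> Hg [Ff [F1 Fub]].
have F0 : F !=set0 by have [[p [Fp _]] _] := F1; exists (p ord0).
have [x [Fx FE]] : exists x, F x /\ F = Fset g (Eset g x).
  by apply: (@face_Fset _ _ g finset.set0); rewrite ?Fset_set0.
have xX : Xbar g x by move: Fx; rewrite FE => -[].
have xc := Eset_compat Hg xX.
have [T [xT Tc T1 Tr]] := rigid_extension Hg xc.
exists T; first by apply/(nc_alt_treeP _ Hg).
have x1 : (ord0, ord_max) \notin Eset g x.
  apply/negP => x1; apply: Fub.
  have [M XM] := Xg_bounded g; exists M => y Fy; apply: XM.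
  rewrite -Fset_edge1n; apply: Fset_sub (_ : Fset g (Eset g x) y).
    by rewrite edge1nE finset.sub1set.
  by rewrite -FE.
rewrite FE in F1 *; congr (Fset g _).
move/(affdim_card _ Hg xc): F1 => cx.
apply/eqP; rewrite eqEcard; apply/andP; split.
  by rewrite finset.subsetD xT disjoint_sym edge1nE disjoints1.
rewrite cardsD (finset.setIidPr (edge1n_tree Hg Tc Tr)) (card_rigid Hg Tc Tr).
by rewrite card_edge1n; lia.
Qed.

Lemma tree_ext_ray g T : expansive g -> nc_alt_tree T ->
  ext_ray (Xbar g) (Fset g (T :\: edge1n n)).
Proof.
move=> Hg Tt; have [Tc Tr] := (nc_alt_treeP T Hg).1 Tt.
have Dc : compat (T :\: edge1n n) by apply: compat_sub Tc; apply: finset.subsetDl.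
split; last split.
- rewrite -Fset_set0; apply: Fset_face; [exact: finset.sub0set|exact: Dc.1].
- apply/affdim_card => //.
  by rewrite cardsD (finset.setIidPr (edge1n_tree Hg Tc Tr)) (card_rigid Hg Tc Tr)
    card_edge1n; lia.
- exact: Fset_unbounded.
Qed.

(** * Faces of [Xg g] and dissections of the polygon *)

(* The edge [ij] of [{1..n}] corresponds to the diagonal joining vertices [i]
   and [j+1] of the [(n+1)]-gon. *)
Definition diag_of_edge (e : 'I_n * 'I_n) : 'I_n.+1 * 'I_n.+1 :=
  (widen_ord (leqnSn n) e.1, lift ord0 e.2).

(** The edge [1n] corresponds to the polygon side joining the first and last vertices, which is no
    diagonal; it is added because it is tight on all of [Xg g]. *)
Definition dissection_graph (D : {set 'I_n.+1 * 'I_n.+1}) : {set 'I_n * 'I_n} :=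
  edge1n n :|:
  [set e : 'I_n * 'I_n | (e.1 < e.2)%N && (diag_of_edge e \in D)]%SET.

Lemma diag_of_edge_inj : injective diag_of_edge.
Proof.
move=> [i j] [k l] [/= ik jl].
by congr pair; apply: ord_inj => //; move: jl; rewrite /bump /=; lia.
Qed.

Lemma diagonal_edge (q : 'I_n.+1 * 'I_n.+1) : Defs.diagonal q ->
  exists e : 'I_n * 'I_n, [/\ diag_of_edge e = q, (e.1 < e.2)%N & e \notin edge1n n].
Proof.
case: q => a b; rewrite /Defs.diagonal negb_and => /andP[/= ab nab].
have Ha : (a < n)%N by have := ltn_ord b; lia.
have Hb : (b.-1 < n)%N by have := ltn_ord b; lia.
exists (Ordinal Ha, Ordinal Hb); split => /=; last 1 first.
- by rewrite inE /= negb_and; move: nab => /orP[->//|nb]; apply/orP; right; lia.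
- by congr pair; apply: ord_inj => //=; rewrite /bump /=; lia.
- lia.
Qed.

(** Shifting upper endpoints by one turns the pattern [i < j <= k < l] into the strict crossing
    [i < j < k+1 < l+1]. *)
Lemma compat_dissection_graph (D : {set 'I_n.+1 * 'I_n.+1}) :
  dissection D -> compat (dissection_graph D).
Proof.
move=> /andP[_ /forall_inP Dx].
apply: compat_edge1nU; split=> [i j|i j k l]; first by rewrite inE => /andP[].
rewrite !inE /= => /andP[ik Dik] /andP[jl Djl] /andP[ij jk] kl.
have /forall_inP/(_ _ Djl) := Dx _ Dik.
by case/negP; rewrite /= /bump /=; lia.
Qed.

Lemma dissection_graph_surj T : compat T -> edge1n n \subset T ->
  exists2 D, dissection D & dissection_graph D = T.
Proof.
move=> Tc T1; exists (diag_of_edge @: (T :\: edge1n n)); last first.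
  apply/setP => e; rewrite finset.in_setU [X in _ || X]finset.in_set.
  rewrite (mem_imset _ _ diag_of_edge_inj) finset.in_setD.
  case: (boolP (e \in edge1n n)) => [/(fintype.subsetP T1)-> //|_] /=.
  by apply/andP/idP => [[]//|]; case: e => i j Te; split=> //; apply: Tc.1.
apply/andP; split.
  apply/forall_inP => _ /imsetP[[i j] + ->]; rewrite finset.in_setD => /andP[e1 Te].
  have ij := Tc.1 _ _ Te; rewrite /Defs.diagonal /= /bump /= add1n ltnS ij /=.
  by apply: contra e1; rewrite inE.
apply/forall_inP => _ /imsetP[[i k] + ->]; rewrite finset.in_setD => /andP[_ Tik].
apply/forall_inP => _ /imsetP[[j l] + ->]; rewrite finset.in_setD => /andP[_ Tjl].
apply/negP => /=; rewrite /bump /= !add1n !ltnS => /and3P[ij jk kl].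
by apply: (Tc.2 _ _ _ _ Tik Tjl) => //; rewrite ij.
Qed.

Lemma dissection_graph_sub (D1 D2 : {set 'I_n.+1 * 'I_n.+1}) :
  dissection D1 ->
  D1 \subset D2 <-> dissection_graph D1 \subset dissection_graph D2.
Proof.
move=> /andP[/forall_inP D1d _]; split=> [D12|sub].
  apply: finset.setUS; apply/fintype.subsetP => e; rewrite !inE.
  by case/andP=> -> /(fintype.subsetP D12).
apply/fintype.subsetP => q qD; have [e [eq e12 e1]] := diagonal_edge (D1d _ qD).
have : e \in dissection_graph D1.
  by rewrite finset.in_setU [X in _ || X]finset.in_set e12 eq qD orbT.
move/(fintype.subsetP sub); rewrite finset.in_setU [X in _ || X]finset.in_set.
by rewrite (negbTE e1) e12 eq.
Qed.

Lemma face_dissection g F : expansive g ->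
  nonempty_face (Fset g (edge1n n)) F ->
  exists2 D, dissection D & Fset g (dissection_graph D) = F.
Proof.
move=> Hg [Ff F0]; have [x [Fx FE]] := face_Fset Ff F0.
have [xX x1] : Fset g (edge1n n) x.
  by have [c [d [_ E]]] := Ff; move: Fx; rewrite E => -[].
have [D Dd DE] := dissection_graph_surj (Eset_compat Hg xX) x1.
by exists D; rewrite ?DE.
Qed.

Lemma dissection_face g (D : {set 'I_n.+1 * 'I_n.+1}) :
  expansive g -> dissection D ->
  nonempty_face (Fset g (edge1n n)) (Fset g (dissection_graph D)).
Proof.
move=> Hg /compat_dissection_graph Dc; split.
  by apply: Fset_face Dc.1; apply: finset.subsetUl.
by have [v vX vD] := Eset_surj Hg Dc; exists v; split; rewrite ?vD.
Qed.

End Main.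

Theorem theorem5p9 (R : realType) (n : nat) (g : 'I_n -> 'I_n -> R) :
  (2 <= n)%N ->
  (forall i j k l : 'I_n, (i < j)%N -> (j < k)%N -> (k < l)%N ->
     g i k + g j l < g i l + g j k) ->
  (forall i k l : 'I_n, (i < k)%N -> (k < l)%N -> g i k + g k l < g i l) ->
  (* X_g is a simple (n-2)-dimensional polytope ... *)
  simple_polytope (Xg g) (n - 2) /\
  (* ... whose face poset is that of the (n-2)-dim associahedron *)
  (exists phi : {set 'I_n.+1 * 'I_n.+1} -> set 'rV[R]_n,
     (forall D, dissection D -> nonempty_face (Xg g) (phi D)) /\
     (forall F, nonempty_face (Xg g) F -> exists2 D, dissection D & phi D = F) /\
     (forall D1 D2, dissection D1 -> dissection D2 ->
        (D1 \subset D2 <-> phi D2 `<=` phi D1))) /\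
  (* v |-> E(v) is a bijection from vertices of X_g to NC alternating trees *)
  (forall v, vertex (Xg g) v -> nc_alt_tree (Eset g v)) /\
  (forall u v, vertex (Xg g) u -> vertex (Xg g) v -> Eset g u = Eset g v -> u = v) /\
  (forall T, nc_alt_tree T -> exists v, vertex (Xg g) v /\ Eset g v = T) /\
  (* adjacency <-> trees differ in a single edge *)
  (forall u v, vertex (Xg g) u -> vertex (Xg g) v ->
     (adjacent (Xg g) u v <-> #|Eset g u :\: Eset g v| = 1%N)) /\
  (* Xbar_g is unbounded with the same vertices *)
  ~ bounded (Xbar g) /\
  (forall v, vertex (Xbar g) v <-> vertex (Xg g) v) /\
  (* extreme rays <-> NC alternating trees minus the edge 1n *)
  (forall F, ext_ray (Xbar g) F ->
     exists2 T, nc_alt_tree T & Eface g F = T :\: edge1n n) /\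
  (forall F1 F2, ext_ray (Xbar g) F1 -> ext_ray (Xbar g) F2 ->
     Eface g F1 = Eface g F2 -> F1 = F2) /\
  (forall T, nc_alt_tree T ->
     exists2 F, ext_ray (Xbar g) F & Eface g F = T :\: edge1n n).
Proof.
case: n g => [|[|m]] // g _ H1 H2.
have Hg := expansiveP H1 H2.
have ss := fintype.subxx (edge1n m.+2).
have compatD T : nc_alt_tree T -> compat (T :\: edge1n m.+2).
  move=> /(nc_alt_treeP _ Hg)[Tc _].
  by apply: compat_sub Tc; apply: finset.subsetDl.
have -> : (m.+2 - 2 = m)%N by rewrite !subSS subn0.
split.
  split; first exact: Xg_bounded.
  rewrite -Fset_edge1n; split; last split.
  - have [v vX v1] := Eset_surj Hg (@compat_edge1n m).
    by exists v; split; rewrite ?v1.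
  - by apply/affdim_card; rewrite ?card_edge1n //; apply: compat_edge1n.
  - by move=> v; apply: facets_at_vertex.
rewrite -Fset_edge1n.
split.
  exists (fun D => Fset g (dissection_graph D)); split; last split.
  - by move=> D; apply: dissection_face.
  - by move=> F; apply: face_dissection.
  - move=> D1 D2 D1d D2d.
    rewrite dissection_graph_sub //; split; first exact: Fset_sub.
    by apply: Fset_le => //; apply: compat_dissection_graph.
split; first by move=> v /(vertexP _ Hg ss)[].
split.
  move=> u v /(vertexP _ Hg ss)[uX _] /(vertexP _ Hg ss)[vX vt].
  exact: Eset_inj Hg uX vX vt.
split; first by move=> T; apply: tree_vertex.
split; first by move=> u v; apply: adjacent_tree.
split; first exact: Xbar_unbounded.
split.
  (* Both sides are equivalent to the same tree condition, by [vertexP] with [B] empty and with [B]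
     equal to [edge1n]. *)
  move=> v; rewrite -Fset_set0.
  apply: iff_trans (vertexP v Hg (finset.sub0set _)) _.
  by apply: iff_sym; apply: vertexP.
split.
  move=> F /(ext_ray_tree Hg)[T Tt ->]; exists T => //.
  by apply: Eface_Fset => //; apply: compatD.
split.
  move=> _ _ /(ext_ray_tree Hg)[T1 T1t ->] /(ext_ray_tree Hg)[T2 T2t ->].
  have T1c := compatD T1 T1t; have T2c := compatD T2 T2t.
  by rewrite !Eface_Fset // => ->.
move=> T Tt; exists (Fset g (T :\: edge1n m.+2)); first exact: tree_ext_ray.
by apply: Eface_Fset => //; apply: compatD.
Qed.
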